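(* Let $\kappa$ be a singular cardinal and $X={}^{<\kappa}\square\,2^\kappa$. Then for every $x\in X$, the character $\chi(x,X)$ is greater than $\mathrm{cf}(\kappa)$.
   Context: $2=\{0,1\}$ is discrete. ${}^{<\kappa}\square\,2^\kappa$ is the set of functions $\kappa\to2$ with basic open sets $[s]=\{f:s\subseteq f\}$ for partial functions $s:\kappa\to 2$ with $|\mathrm{dom}(s)|<\kappa$. $\chi(x,X)$ is the least cardinality of a neighbourhood base at $x$ in $X$. *)

(* Defs.v *)
From HB Require Import structures.
From mathcomp Require Import all_boot all_order.
From mathcomp Require Import finmap boolp classical_sets functions cardinality.
From mathcomp Require Import wochoice filter topology.

Set Implicit Arguments.
Unset Strict Implicit.
Unset Printing Implicit Defensive.

Import Order.TTheory.

Local Open Scope classical_set_scope.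
Local Open Scope card_scope.

Definition card_lt T U (A : set T) (B : set U) : bool :=
  (A #<= B) && ~~ (B #<= A).
Notation "A '#<' B" := (card_lt A B) (at level 79) : card_scope.

(* A cardinal is represented by a set of that cardinality, so the least
   cardinality of a member of a family is attained by one of the members:
   see least_cardP. *)
Definition least_card T (F : set (set T)) : set T :=
  xget set0 [set A | F A /\ forall B, F B -> A #<= B].

Lemma min_card_exists T (F : set (set T)) :
  F !=set0 -> exists2 A, F A & forall B, F B -> A #<= B.
Proof.
move=> [A0 FA0].
(* maximal families of selectors, pairwise different at every member of F *)
pose P (G : set (set T -> T)) :=
  (forall g A, G g -> F A -> A (g A)) /\
  (forall g h A, G g -> G h -> F A -> g A = h A -> g = h).
have [G [[Gsel Ginj] Gmax]] : exists G, P G /\ forall B, G `<` B -> ~ P B.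
  apply: Zorn_bigcup => C CP Ctot; split.
    by move=> g A [X CX Xg] FA; have [H _] := CP _ CX; exact: (H g A).
  move=> g h A [X CX Xg] [Y CY Yh] FA gh.
  have [XY|YX] := Ctot _ _ CX CY.
    by have [_ /(_ g h A)] := CP _ CY; apply=> //; exact: XY.
  by have [_ /(_ g h A)] := CP _ CX; apply=> //; exact: YX.
have [A FA AG] : exists2 A, F A & A `<=` (fun g => g A) @` G.
  apply: contrapT => noA.
  have miss A : exists a, F A -> A a /\ ~ ((fun g => g A) @` G) a.
    have [FA|nFA] := pselect (F A).
      apply: contrapT => /forallNP H; apply: noA; exists A => // a Aa.
      by apply: contrapT => Ga; apply: (H a).
    have /existsNP[a _] : ~ (A0 `<=` (fun g => g A0) @` G).
      by move=> H; apply: noA; exists A0.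
    by exists a.
  have [h hP] := choice miss.
  have hG : ~ G h.
    by move=> Gh; have [_] := hP _ FA0; apply; exists h.
  apply: (Gmax (h |` G)).
    split; first by move=> g Gg; right.
    by move=> /(_ h (or_introl erefl)).
  split.
    by move=> g A [->|Gg] FA; [have [] := hP _ FA|exact: (Gsel g A)].
  move=> g k A [->|Gg] [->|Gk] FA // e.
  - by have [_ []] := hP _ FA; exists k.
  - by have [_ []] := hP _ FA; exists g.
  - exact: Ginj e.
exists A => // B FB.
apply: (card_le_trans (subset_card_le AG)).
apply: (card_le_trans (card_image_le _ _)).
have BG : (fun g => g B) @` G #= G.
  by apply: inj_card_eq => g h /set_mem Gg /set_mem Gh /Ginj; apply.
move: BG; rewrite card_eq_le => /andP[_ BG]; apply: card_le_trans BG _.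
by apply: subset_card_le => _ [g Gg <-]; exact: (Gsel g B).
Qed.

Lemma least_cardP T (F : set (set T)) : F !=set0 ->
  F (least_card F) /\ forall A, F A -> least_card F #<= A.
Proof.
move=> /min_card_exists[A FA Amin]; rewrite /least_card.
by case: xgetP => [B _ //|/(_ A) []].
Qed.

Section cardinals.
Context {d : Order.disp_t} (K : orderType d).

(* an initial ordinal: a well-order, larger than each of its proper initial
   segments *)
Definition is_cardinal : Prop :=
  well_order (<=%O : rel K) /\
  forall a : K, [set b : K | (b < a)%O] #< [set: K].

Definition cofinal (C : set K) : Prop :=
  forall a : K, exists2 c, C c & (a <= c)%O.

Definition cofinality : set K := least_card cofinal.

Lemma cofinalityP :
  cofinal cofinality /\ forall C, cofinal C -> cofinality #<= C.
Proof. by apply: least_cardP; exists setT => a; exists a. Qed.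

Definition singular_cardinal : Prop :=
  [/\ is_cardinal, infinite_set [set: K] & cofinality #< [set: K]].

End cardinals.
Arguments cofinality {d} K.
Arguments singular_cardinal {d} K.

Section character.
Context {T : topologicalType}.

Definition nbhs_base (x : T) (B : set (set T)) : Prop :=
  B `<=` nbhs x /\ forall U, nbhs x U -> exists2 V, B V & V `<=` U.

Definition character (x : T) : set (set T) := least_card (nbhs_base x).

Lemma characterP (x : T) :
  nbhs_base x (character x) /\
  forall B, nbhs_base x B -> character x #<= B.
Proof. by apply: least_cardP; exists (nbhs x); split=> // U xU; exists U. Qed.

End character.

Definition box_power (K : Type) : Type := K -> bool.

Section box_power.
Context {K : Type}.

Definition pdom (s : K -> option bool) : set K := [set k | s k].

Definition cylinder (s : K -> option bool) : set (box_power K) :=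
  [set f | forall k b, s k = Some b -> f k = b].

Definition box_basis : set (set (box_power K)) :=
  [set cylinder s | s in [set s | pdom s #< [set: K]]].

End box_power.
Arguments box_basis K : clear implicits.

(* The topology generated by box_basis; box_basis is a base of it whenever K is
   infinite, see box_basisP. *)
HB.instance Definition _ (K : Type) := Pointed.copy (box_power K) (K -> bool).
HB.instance Definition _ (K : Type) :=
  isSubBaseTopological.Build (box_power K) (box_basis K) id.

Section box_basis_lemmas.
Context {K : Type}.
Implicit Types A B C : set K.

Let inj_le {T U} (f : T -> U) (A : set T) (B : set U) :
  (forall x, A x -> B (f x)) -> {in A &, injective f} -> A #<= B.
Proof.
move=> fAB fi; have := inj_card_eq fi.
rewrite card_eq_le => /andP[_ fA]; apply: card_le_trans fA _.
by apply: subset_card_le => _ [x Ax <-]; exact: fAB.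
Qed.

Let le_inj {T U} (u : U) (A : set T) (B : set U) : A #<= B ->
  exists2 f : T -> U, (forall x, A x -> B (f x)) & {in A &, injective f}.
Proof.
pose U' := HB.pack_for pointedType U (gen_eqMixin U) (gen_choiceMixin U)
  (isPointed.Build U u).
by move=> /(@pcard_leP _ U')/injfunPex[f fAB fi]; exists f.
Qed.

(* B + B is equinumerous to B *)
Let infinite_double B : infinite_set B ->
  exists h : K * bool -> K, (forall x b, B x -> B (h (x, b))) /\
    forall x b y c, B x -> B y -> h (x, b) = h (y, c) -> (x, b) = (y, c).
Proof.
move=> Binf.
pose P (S : set (nat -> K)) :=
  (forall s n, S s -> B (s n)) /\
  (forall s t n m, S s -> S t -> s n = t m -> s = t /\ n = m).
have [S [[SB Sinj] Smax]] : exists S, P S /\ forall S', S `<` S' -> ~ P S'.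
  apply: Zorn_bigcup => C CP Ctot; split.
    by move=> s n [X CX Xs]; have [H _] := CP _ CX; exact: H.
  move=> s t n m [X CX Xs] [Y CY Yt] st.
  have [XY|YX] := Ctot _ _ CX CY.
    by have [_ /(_ s t n m)] := CP _ CY; apply=> //; exact: XY.
  by have [_ /(_ s t n m)] := CP _ CX; apply=> //; exact: YX.
pose U := [set x | exists s n, S s /\ s n = x].
have Rfin : finite_set (B `\` U).
  have [//|/infiniteP natR] := pselect (finite_set (B `\` U)).
  have [x0 _] := infinite_setN0 Binf.
  have [s sR si] := le_inj x0 natR.
  have nU n : ~ U (s n) by have [] := sR n I.
  exfalso; apply: (Smax (s |` S)).
    split; first by move=> t St; right.
    move=> /(_ s (or_introl erefl)) Ss.
    by apply: (nU 0); exists s, 0.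
  split.
    by move=> t n [->|St]; [have [] := sR n I|exact: SB].
  move=> t t' n m [->|St] [->|St'] e.
  - by split=> //; apply: si; rewrite ?in_setT.
  - by exfalso; apply: (nU n); rewrite e; exists t', m.
  - by exfalso; apply: (nU m); rewrite -e; exists t, n.
  - exact: Sinj e.
have [s0 Ss0] : S !=set0.
  apply: contrapT => S0; apply: Binf; suff <- : B `\` U = B by [].
  apply/seteqP; split=> [x []//|x Bx]; split=> // -[s [n [Ss _]]].
  by apply: S0; exists s.
have [N] := Rfin; rewrite card_eq_le => /andP[+ _].
move=> /(le_inj 0%N)[r rN ri].
have dec x : exists p : (nat -> K) * nat, U x -> S p.1 /\ p.1 p.2 = x.
  have [[s [n [Ss sn]]]|nU] := pselect (U x); first by exists (s, n).
  by exists (s0, 0).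
have [p pP] := choice dec.
(* an injection of B into S * nat *)
pose q x : (nat -> K) * nat :=
  if `[< U x >] then
    (if `[< (p x).1 = s0 >] then (s0, N + (p x).2) else p x)
  else (s0, r x).
have qS x : S (q x).1.
  rewrite /q; case: asboolP => // Ux; case: asboolP => // _.
  by have [] := pP _ Ux.
have qi x y : B x -> B y -> q x = q y -> x = y.
  move=> Bx By; rewrite /q.
  case: (asboolP (U x)) => Ux; case: (asboolP (U y)) => Uy.
  - have [_ xE] := pP _ Ux; have [_ yE] := pP _ Uy.
    suff H : p x = p y -> x = y.
      case: asboolP => xs; case: asboolP => ys.
      + by case=> /addnI e; rewrite -xE -yE xs ys e.
      + by move=> e; exfalso; apply: ys; rewrite -e.
      + by move=> e; exfalso; apply: xs; rewrite e.
      + exact: H.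
    by move=> e; rewrite -xE -yE e.
  - have ryN : (r y < N)%N by exact: (rN y (conj By Uy)).
    case: asboolP => xs.
      by case=> e; move: ryN; rewrite -e ltnNge leq_addr.
    by move=> e; exfalso; apply: xs; rewrite e.
  - have rxN : (r x < N)%N by exact: (rN x (conj Bx Ux)).
    case: asboolP => ys.
      by case=> e; move: rxN; rewrite e ltnNge leq_addr.
    by move=> e; exfalso; apply: ys; rewrite -e.
  - by case=> e; apply: ri => //; rewrite inE; split.
exists (fun xb : K * bool => (q xb.1).1 ((q xb.1).2.*2 + xb.2)%N); split.
  by move=> x b Bx; apply: SB.
move=> x b y c Bx By /= /(Sinj _ _ _ _ (qS x) (qS y))[e1 e2].
have bc : b = c.
  by have := congr1 odd e2; rewrite !oddD !odd_double; case: b c {e2} => -[].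
rewrite -bc in e2 *; congr (_, _); apply: qi => //.
move: e2 => /addIn /double_inj e2.
by rewrite [q x]surjective_pairing [q y]surjective_pairing e1 e2.
Qed.

Lemma card_lt_setU A B : infinite_set [set: K] ->
  A #< [set: K] -> B #< [set: K] -> A `|` B #< [set: K].
Proof.
move=> Kinf.
wlog AB : A B / A #<= B => [wl|] AK BK.
  have [|C CAB Cmin] := @min_card_exists _ [set A; B]; first by exists A; left.
  case: CAB Cmin => -> Cmin.
    by apply: wl => //; apply: Cmin; right.
  by rewrite setUC; apply: wl => //; apply: Cmin; left.
rewrite /card_lt card_leT /=; apply/negP => KAB.
have [Bf|Binf] := pselect (finite_set B).
  apply: Kinf; apply: card_le_finite KAB _.
  by rewrite finite_setU; split=> //; exact: card_le_finite AB Bf.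
have [h [hB hi]] := infinite_double Binf.
have [x0 _] := infinite_setN0 Kinf.
have [f fB fi] := le_inj x0 AB.
case/andP: BK => _ /negP; apply; apply: card_le_trans KAB _.
apply: (@inj_le _ _ (fun x => if `[< A x >] then h (f x, true)
                              else h (x, false))).
  by move=> x; case: asboolP => Ax [] // ?; apply: hB => //; exact: fB.
move=> x y; rewrite !inE => ABx ABy.
case: asboolP => Ax; case: asboolP => Ay.
- by move=> /(hi _ _ _ _ (fB _ Ax) (fB _ Ay))[] /fi; apply; rewrite inE.
- by case: ABy => // By /(hi _ _ _ _ (fB _ Ax) By)[].
- by case: ABx => // Bx /(hi _ _ _ _ Bx (fB _ Ay))[].
- by case: ABx ABy => // Bx [//|By] /(hi _ _ _ _ Bx By)[].
Qed.

Lemma box_basisP : infinite_set [set: K] ->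
  basis (box_basis K : set (set (box_power K))).
Proof.
move=> Kinf; split.
  move=> _ [s sK <-].
  exists [set cylinder s]; last by rewrite bigcup_set1.
  by move=> _ ->; apply: (@finI_from1 _ _ _ id); exists s.
move=> x A; rewrite nbhsE => -[V [[D' D'sub DV] Vx] VA].
move: Vx; rewrite -DV => -[W D'W Wx].
have WV : W `<=` V by move=> y Wy; rewrite -DV; exists W.
have [F Fsub FW] := D'sub _ D'W.
(* finitely many cylinders at x contain a common cylinder at x *)
pose r (D : set K) k := if `[< D k >] then Some (x k) else None.
have rD D : pdom (r D) = D.
  by apply/seteqP; split=> k; rewrite /pdom /r /=; case: asboolP.
have rx D : cylinder (r D) x.
  by move=> k b; rewrite /r; case: asboolP => // _ [].
have [D DK DF] : exists2 D : set K, D #< [set: K] &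
    forall U, U \in (F : seq _) -> cylinder (r D) `<=` U.
  have: forall U, U \in (F : seq _) -> box_basis K U /\ U x.
    move=> U UF; split; first by have := Fsub _ UF; rewrite inE.
    by move: Wx; rewrite -FW; exact.
  elim: (F : seq _) => [_|U l IH Ul].
    exists set0 => //; rewrite /card_lt card_ge0 card_le0.
    by apply/eqP => K0; apply: Kinf; rewrite K0.
  have [D DK Dl] : exists2 D : set K, D #< [set: K] &
      forall V, V \in l -> cylinder (r D) `<=` V.
    by apply: IH => Z Zl; apply: Ul; rewrite inE Zl orbT.
  have [[s sK sU] Ux] := Ul U (mem_head _ _).
  exists (pdom s `|` D); first exact: card_lt_setU.
  move=> Z; rewrite inE => /orP[/eqP -> f fr|/Dl DZ f fr].
    rewrite -sU => k b skb; move: Ux; rewrite -sU => /(_ _ _ skb) <-.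
    by apply: fr; rewrite /r; case: asboolP => // -[]; left; rewrite /pdom /= skb.
  apply: DZ => k b; rewrite {1}/r; case: asboolP => // Dk [<-].
  by apply: fr; rewrite /r; case: asboolP => // -[]; right.
exists (cylinder (r D)).
  by split; [exists (r D); rewrite /= ?rD|exact: rx].
apply: subset_trans VA; apply: subset_trans WV.
by rewrite -FW => f fD U UF; exact: DF fD.
Qed.

End box_basis_lemmas.

(* Main.v *)
Require Import Defs.
From mathcomp Require Import all_boot all_order.
From mathcomp Require Import boolp classical_sets cardinality topology.

Local Open Scope classical_set_scope.
Local Open Scope card_scope.

(** Suppose that [x] had a neighbourhood base [B] with [#|B| < #|K|]. Every [V]
    in [B] contains a cylinder around [x] whose domain misses some point [a V].
    The cylinder of [x] over the set of these points is then a neighbourhood of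
    [x] including no [V] in [B]: flipping [x] at [a V] stays inside [V]. So the
    character is at least [#|K|], which exceeds [cf(K)] when [K] is singular. *)

(** [min_card_exists] compares sets of one type only, so both sets are copied into [T + U]; a
    smallest one of the two copies decides the comparison. *)
Lemma card_le_total {T U} (A : set T) (B : set U) : A #<= B \/ B #<= A.
Proof.
pose A' := [set (inl a : T + U) | a in A].
pose B' := [set (inr b : T + U) | b in B].
have AA' : A' #= A by apply: inj_card_eq => a b _ _ [].
have BB' : B' #= B by apply: inj_card_eq => a b _ _ [].
have le_imgs : A' #<= B' \/ B' #<= A'.
  have [|C CAB Cmin] := @min_card_exists _ [set A'; B']; first by exists A'; left.
  by case: CAB Cmin => -> Cmin; [left|right]; apply: Cmin; [right|left].
by move: le_imgs; rewrite (card_le_eql AA') (card_le_eqr BB')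
  (card_le_eql BB') (card_le_eqr AA').
Qed.

Lemma card_le_lt_trans {T U V} {A : set T} {B : set U} {C : set V} :
  A #<= B -> B #< C -> A #< C.
Proof.
move=> AB /andP[BC CB]; rewrite /card_lt (card_le_trans AB BC) /=.
by apply: contra CB => CA; exact: card_le_trans CA AB.
Qed.

Lemma card_lt_le_trans {T U V} {A : set T} {B : set U} {C : set V} :
  A #< B -> B #<= C -> A #< C.
Proof.
move=> /andP[AB BA] BC; rewrite /card_lt (card_le_trans AB BC) /=.
by apply: contra BA => CA; exact: card_le_trans BC CA.
Qed.

Lemma nbhs_base_card_ge {K : Type} {x : box_power K}
    {B : set (set (box_power K))} :
  infinite_set [set: K] -> nbhs_base x B -> [set: K] #<= B.
Proof.
move=> Kinf [Bx xB]; have [Bopen Bnbhs] := box_basisP Kinf.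
apply: contrapT => /negP KB.
have BK : B #< [set: K].
  rewrite /card_lt KB andbT.
  by case: (card_le_total B [set: K]) => // /(negP KB).
(* [B V] is assumed only under [exists a], so that [choice] gives a total function; off [B] its
   value is an arbitrary [k]. *)
have avoid V : exists a : K, B V -> exists s : K -> option bool,
    [/\ cylinder s x, cylinder s `<=` V & s a = None].
  have [k _] := infinite_setN0 Kinf.
  have [BV|] := pselect (B V); last by exists k.
  have [_ [[s sK <-] sx] sV] := Bnbhs _ _ (Bx _ BV).
  have /existsNP[a sa] : ~ forall a, pdom s a.
    move=> sT; move: sK => /andP[_ /negP]; apply.
    by apply: subset_card_le => a _; exact: sT.
  exists a => _; exists s; split=> //; move: sa.
  by rewrite /pdom /=; case: (s a) => // b [].
have [a aP] := choice avoid.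
pose r k := if `[< (a @` B) k >] then Some (x k) else None.
have rx : nbhs x (cylinder r).
  apply: open_nbhs_nbhs; split; last first.
    by move=> k b; rewrite /r; case: asboolP => // _ [].
  apply: Bopen; exists r => //=.
  (* The domain of [r] is the image of [B] under [a], so it is no larger than [B]. *)
  apply: card_le_lt_trans BK; apply: card_le_trans (card_image_le a B).
  by apply: subset_card_le => k; rewrite /pdom /r /=; case: asboolP.
have [V BV Vr] := xB _ rx.
have [s [sx sV sa]] := aP _ BV.
pose f k := if `[< k = a V >] then ~~ x k else x k.
have fs : cylinder s f.
  move=> k b skb; rewrite /f; case: asboolP => [ka|_]; last exact: sx.
  by move: skb; rewrite ka sa.
(* [f] lies in [V], hence in [cylinder r], whose domain contains [a V]; this contradicts the
   flip. *)
have : f (a V) = x (a V).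
  by apply: (Vr _ (sV _ fs)); rewrite /r; case: asboolP.
by rewrite /f; case: asboolP => // _; case: (x (a V)).
Qed.

Theorem theorem7p10 (d : Order.disp_t) (K : orderType d)
  (hK : singular_cardinal K) (x : box_power K) :
  cofinality K #< character x.
Proof.
case: hK => _ Kinf cofK; apply: card_lt_le_trans cofK _.
exact: nbhs_base_card_ge Kinf (characterP x).1.
Qed.
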